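(* Let $\Gamma$ be a conservative valued constraint language on a finite domain $D$ such that $G_\Gamma$ has no soft self-loop, and let $M_1,M_2$ be a partition of $M$ into two sets each of which is independent in $G_\Gamma$. Define binary operations $\sqcap,\sqcup$ on $D$ by $(\sqcap(x,y),\sqcup(x,y))=(x,y)$ if $(x,y)\in M_1$; $=(y,x)$ if $(x,y)\in M_2$; and $=(x,y)$ otherwise. Then $\langle\sqcap,\sqcup\rangle$ is a multimorphism of $\Gamma$.
   Context: A weighted relation of arity $r$ on $D$ is a map $D^r\to\mathbb{Q}\cup\{\infty\}$; a relation has values in $\{0,\infty\}$. $\mathrm{Feas}(\gamma)=\{\mathbf{x}:\gamma(\mathbf{x})<\infty\}$, $\mathrm{Opt}(\gamma)$ is the relation of tuples in $\mathrm{Feas}(\gamma)$ of minimum value. $\Gamma$ is conservative if it contains all unary weighted relations $D\to\{0,1\}$. $\mathcal{C}(\Gamma)$ is the smallest set of weighted relations on $D$ containing $\Gamma$, all unary weighted relations on $D$ and the binary equality relation on $D$, and closed under: $\mathrm{Feas}$ and $\mathrm{Opt}$; adding a unary weighted relation $\mu$ at a coordinate $i$ ($\gamma'(\mathbf{x})=\gamma(\mathbf{x})+\mu(x_i)$); minimisation at a coordinate; and join of binary $\gamma_1,\gamma_2$: $\gamma(x,y)=\min_{z\in D}(\gamma_1(u_1,v_1)+\gamma_2(u_2,v_2))$ with $\{u_1,v_1\}=\{x,z\}$, $\{u_2,v_2\}=\{y,z\}$ (either order). $G_\Gamma$ is the undirected graph (self-loops allowed) on vertices $(a,b)\in D^2$,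 $a\ne b$, with an edge $(a_1,b_1)-(a_2,b_2)$ iff there is a binary $\gamma\in\mathcal{C}(\Gamma)$ with $(a_1,b_2),(b_1,a_2)\in\mathrm{Feas}(\gamma)$ and $\gamma(a_1,b_2)+\gamma(b_1,a_2)<\gamma(a_1,a_2)+\gamma(b_1,b_2)$; the edge is soft if some such $\gamma$ also has at least one of $(a_1,a_2),(b_1,b_2)$ in $\mathrm{Feas}(\gamma)$. $M$ is the set of vertices of $G_\Gamma$ without a self-loop. A set of vertices is independent if no edge joins two of its vertices. Operations act on tuples componentwise. A list $\langle f_1,..,f_k\rangle$ of $k$-ary operations is a multimorphism of $\gamma$ if for all $\mathbf{x}^1,..,\mathbf{x}^k\in\mathrm{Feas}(\gamma)$ each $f_i(\mathbf{x}^1,..,\mathbf{x}^k)\in\mathrm{Feas}(\gamma)$ and $\sum_i\gamma(f_i(\mathbf{x}^1,..,\mathbf{x}^k))\le\sum_i\gamma(\mathbf{x}^i)$; it is a multimorphism of $\Gamma$ if it is one of every $\gamma\in\Gamma$. *)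

(* Defs.v *)
From HB Require Import structures.
From mathcomp Require Import all_boot all_order all_algebra.

Set Implicit Arguments.
Unset Strict Implicit.
Unset Printing Implicit Defensive.

Import Order.TTheory GRing.Theory Num.Theory.
Local Open Scope ring_scope.

(* The rationals with a point at infinity: [None] is infinity.  The additive
   monoid and the total order are declared as canonical structures so that
   [+], [\sum], [<=], [<] and [Order.min] are the library's. *)
Definition qinf : Type := option rat.
Definition qfin (q : rat) : qinf := Some q.
Definition infty : qinf := None.

HB.instance Definition _ := Choice.on qinf.

Definition qadd (u v : qinf) : qinf :=
  match u, v with
  | Some p, Some q => Some (p + q)
  | _, _ => None
  end.

Definition qle (u v : qinf) : bool :=
  match u, v with
  | _, None => true
  | None, Some _ => false
  | Some p, Some q => p <= q
  end.

Lemma qaddA : associative qadd.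
Proof. by move=> [p|] [q|] [s|] //=; rewrite addrA. Qed.

Lemma qaddC : commutative qadd.
Proof. by move=> [p|] [q|] //=; rewrite addrC. Qed.

Lemma qadd0 : left_id (qfin 0) qadd.
Proof. by move=> [p|] //=; rewrite add0r. Qed.

HB.instance Definition _ := GRing.isNmodule.Build qinf qaddA qaddC qadd0.

Lemma qle_refl : reflexive qle.
Proof. by move=> [p|] /=. Qed.

Lemma qle_anti : antisymmetric qle.
Proof. by move=> [p|] [q|] //= /le_anti ->. Qed.

Lemma qle_trans : transitive qle.
Proof. by move=> [p|] [q|] [s|] //=; apply: le_trans. Qed.

Lemma qle_total : total qle.
Proof. by move=> [p|] [q|] //=; apply: le_total. Qed.

HB.instance Definition _ :=
  Order.Le_isPOrder.Build ring_display qinf qle_refl qle_anti qle_trans.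
HB.instance Definition _ :=
  Order.POrder_isTotal.Build ring_display qinf qle_total.

Lemma qle_infty (u : qinf) : u <= infty.
Proof. by case: u. Qed.

HB.instance Definition _ := Order.hasTop.Build ring_display qinf qle_infty.

Lemma qmin_infty_l : left_id infty (@Order.min ring_display qinf).
Proof. by move=> u; apply/min_idPr/qle_infty. Qed.

Lemma qmin_infty_r : right_id infty (@Order.min ring_display qinf).
Proof. by move=> u; apply/min_idPl/qle_infty. Qed.

HB.instance Definition _ :=
  Monoid.isMonoidLaw.Build qinf infty (@Order.min ring_display qinf)
    qmin_infty_l qmin_infty_r.

Section WeightedRelations.
Variable D : finType.

Definition wrel (r : nat) := {ffun r.-tuple D -> qinf}.

Definition language := forall r : nat, wrel r -> Prop.

Definition conservative (Gamma : language) :=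
  forall mu : wrel 1,
    (forall x, mu x = qfin 0 \/ mu x = qfin 1) -> Gamma 1%N mu.

Definition feas r (gamma : wrel r) (x : r.-tuple D) : bool :=
  gamma x < infty.

Definition opt r (gamma : wrel r) (x : r.-tuple D) : bool :=
  feas gamma x && [forall y, gamma x <= gamma y].

Definition rel_of r (P : pred (r.-tuple D)) : wrel r :=
  [ffun x => if P x then qfin 0 else infty].

Definition eqrel : wrel 2 :=
  rel_of (fun x : 2.-tuple D => tnth x 0 == tnth x 1).

Definition add_unary r (gamma : wrel r) (mu : wrel 1) (i : 'I_r) : wrel r :=
  [ffun x => gamma x + mu [tuple tnth x i]].

(* [x] with [z] inserted so as to become the [i]-th coordinate *)
Definition insert r (i : 'I_r.+1) (z : D) (x : r.-tuple D) : r.+1.-tuple D :=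
  [tuple if unlift i j is Some k then tnth x k else z | j < r.+1].

Definition minimise r (gamma : wrel r.+1) (i : 'I_r.+1) : wrel r :=
  [ffun x => \big[Order.min/infty]_(z : D) gamma (insert i z x)].

Definition ordered_pair (b : bool) (u v : D) : 2.-tuple D :=
  if b then [tuple u; v] else [tuple v; u].

Definition join (b1 b2 : bool) (gamma1 gamma2 : wrel 2) : wrel 2 :=
  [ffun x => \big[Order.min/infty]_(z : D)
     (gamma1 (ordered_pair b1 (tnth x 0) z) +
      gamma2 (ordered_pair b2 (tnth x 1) z))].

Inductive closure (Gamma : language) : language :=
| closure_base r (gamma : wrel r) :
    Gamma r gamma -> closure Gamma gamma
| closure_unary (mu : wrel 1) : closure Gamma mu
| closure_eq : closure Gamma eqrel
| closure_feas r (gamma : wrel r) :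
    closure Gamma gamma -> closure Gamma (rel_of (feas gamma))
| closure_opt r (gamma : wrel r) :
    closure Gamma gamma -> closure Gamma (rel_of (opt gamma))
| closure_add_unary r (gamma : wrel r) (mu : wrel 1) (i : 'I_r) :
    closure Gamma gamma -> closure Gamma (add_unary gamma mu i)
| closure_minimise r (gamma : wrel r.+1) (i : 'I_r.+1) :
    closure Gamma gamma -> closure Gamma (minimise gamma i)
| closure_join (b1 b2 : bool) (gamma1 gamma2 : wrel 2) :
    closure Gamma gamma1 -> closure Gamma gamma2 ->
    closure Gamma (join b1 b2 gamma1 gamma2).

Definition vertex (p : D * D) : bool := p.1 != p.2.

Definition edge_witness (gamma : wrel 2) (p q : D * D) : bool :=
  [&& feas gamma [tuple p.1; q.2],
      feas gamma [tuple p.2; q.1] &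
      gamma [tuple p.1; q.2] + gamma [tuple p.2; q.1] <
      gamma [tuple p.1; q.1] + gamma [tuple p.2; q.2]].

(* Symmetric in [p] and [q], see [edge_sym] below. *)
Definition edge (Gamma : language) (p q : D * D) : Prop :=
  [/\ vertex p, vertex q &
      exists gamma : wrel 2, closure Gamma gamma /\ edge_witness gamma p q].

Definition soft_edge (Gamma : language) (p q : D * D) : Prop :=
  [/\ vertex p, vertex q &
      exists gamma : wrel 2,
        [/\ closure Gamma gamma, edge_witness gamma p q &
            feas gamma [tuple p.1; q.1] || feas gamma [tuple p.2; q.2]]].

Definition loopless (Gamma : language) (p : D * D) : Prop :=
  vertex p /\ ~ edge Gamma p p.

Definition independent (Gamma : language) (A : {set D * D}) : Prop :=
  forall p q, p \in A -> q \in A -> ~ edge Gamma p q.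

(* One of the two parts may be empty. *)
Definition bipartition (M : D * D -> Prop) (M1 M2 : {set D * D}) : Prop :=
  (forall p, M p <-> p \in M1 :|: M2) /\ [disjoint M1 & M2].

Definition operation (k : nat) := k.-tuple D -> D.

Definition apply_op k r (f : operation k) (xs : k.-tuple (r.-tuple D)) :
    r.-tuple D :=
  [tuple f [tuple tnth (tnth xs j) i | j < k] | i < r].

Definition multimorphism_of k (fs : k.-tuple (operation k)) r
    (gamma : wrel r) : Prop :=
  forall xs : k.-tuple (r.-tuple D),
    (forall i, feas gamma (tnth xs i)) ->
    (forall i, feas gamma (apply_op (tnth fs i) xs)) /\
    \sum_(i < k) gamma (apply_op (tnth fs i) xs) <=
    \sum_(i < k) gamma (tnth xs i).

Definition multimorphism k (fs : k.-tuple (operation k)) (Gamma : language) :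
    Prop :=
  forall r (gamma : wrel r), Gamma r gamma -> multimorphism_of fs gamma.

Definition binary_op (f : D -> D -> D) : operation 2 :=
  fun t => f (tnth t 0) (tnth t 1).

Definition meet_join (M1 M2 : {set D * D}) (x y : D) : D * D :=
  if (x, y) \in M1 then (x, y)
  else if (x, y) \in M2 then (y, x)
  else (x, y).

Definition sqcap (M1 M2 : {set D * D}) (x y : D) : D := (meet_join M1 M2 x y).1.
Definition sqcup (M1 M2 : {set D * D}) (x y : D) : D := (meet_join M1 M2 x y).2.

Lemma join_eqrelE (gamma : wrel 2) (a b : D) :
  join false true gamma eqrel [tuple a; b] = gamma [tuple b; a].
Proof.
rewrite ffunE (bigD1 b) //= big1 => [|z neq_zb].
  by rewrite qmin_infty_r ffunE /tnth /= (eqxx b) [LHS]addr0.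
rewrite ffunE /tnth /= eq_sym (negbTE neq_zb).
by case: (gamma _).
Qed.

Lemma edge_sym (Gamma : language) (p q : D * D) :
  edge Gamma p q -> edge Gamma q p.
Proof.
case=> vp vq [gamma [Cg /and3P [f1 f2 lt12]]]; split=> //.
exists (join false true gamma eqrel); split.
  by apply: closure_join => //; apply: closure_eq.
by rewrite /edge_witness /feas !join_eqrelE; apply/and3P; split=> //;
  rewrite addrC.
Qed.

End WeightedRelations.

(* Main.v *)
Require Import Defs.
From mathcomp Require Import all_boot all_order all_algebra.
From mathcomp Require Import lra.

(** Adding unary weights normalises a witness of an edge [p - q] so that it
    vanishes on the two mixed pairs and is positive on the other two. Joining
    normalised witnesses composes edges, up to reversing a pair, and hence an
    edge into a pair with a self-loop yields a self-loop. So a pair of [M2] has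
    no edge to the reversal of a pair outside [M2]: that reversal would have no
    self-loop, and it would lie in the independent set [M2], since every pair
    has an edge to its reversal.

    Given tuples [x] and [y], the operations exchange [x] and [y] on the set [S]
    of coordinates whose pair is in [M2]. The inequality for this exchange is
    proved by induction on the Hamming distance of [x] and [y]. Minimising out
    all coordinates but one in [S] and one outside [S], the absence of an edge
    yields tuples [u] and [v] of total weight at most that of [x] and [y], with
    entries taken from [x] and [y], in which the two chosen coordinates are
    exchanged as required. If [u] or [v] is not yet the exchanged tuple,
    uncrossing it with [x] and [y] leads to four pairs at smaller distance,
    whose inequalities add up to the desired one. *)

Set Implicit Arguments.
Unset Strict Implicit.
Unset Printing Implicit Defensive.

Import Order.TTheory GRing.Theory Num.Theory.
Local Open Scope ring_scope.

Lemma qfin_leE (p q : rat) : (qfin p <= qfin q) = (p <= q).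
Proof. by []. Qed.

Lemma qfin_ltE (p q : rat) : (qfin p < qfin q) = (p < q).
Proof. by rewrite !ltNge qfin_leE. Qed.

Lemma qfin_addE (p q : rat) : qfin p + qfin q = qfin (p + q).
Proof. by []. Qed.

Lemma add_infty (u : qinf) : infty + u = infty.
Proof. by []. Qed.

Lemma addr_infty (u : qinf) : u + infty = infty.
Proof. by case: u. Qed.

Definition qinfE := (qfin_addE, qfin_leE, qfin_ltE, add_infty, addr_infty).

Lemma lt_inftyP (u : qinf) : reflect (exists q, u = qfin q) (u < infty).
Proof. by case: u => [q|]; constructor; [exists q | case]. Qed.

Lemma add_lt_infty (u v : qinf) : (u + v < infty) = (u < infty) && (v < infty).
Proof. by case: u v => [p|] [q|]. Qed.

Lemma qinf_leD (u v u' v' : qinf) : u <= u' -> v <= v' -> u + v <= u' + v'.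
Proof.
by case: u v u' v' => [p|] [q|] [p'|] [q'|] //; rewrite ?qinfE //; exact: lerD.
Qed.

Lemma qinf_leD2r (w u v : qinf) : w < infty -> (u + w <= v + w) = (u <= v).
Proof.
by case/lt_inftyP=> s ->; case: u v => [p|] [q|] //; rewrite !qinfE lerD2r.
Qed.

Lemma qinf_addr_gt0 (u v : qinf) :
  (0 : qinf) < u -> (0 : qinf) < v -> (0 : qinf) < u + v.
Proof. by case: u v => [p|] [q|] //; rewrite !qfin_ltE; exact: addr_gt0. Qed.

Lemma qfin_add_lt_separate (p q : rat) (u v : qinf) :
  qfin p + qfin q < u + v ->
  exists m : rat, qfin p < u + qfin m /\ qfin q + qfin m < v.
Proof.
case: u v => [u|] [v|]; rewrite ?qinfE // => lt_pq.
- by exists ((p - u + (v - q)) / 2%:R); rewrite !qinfE; split; lra.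
- by exists (p - u + 1); rewrite !qinfE; split=> //; lra.
- by exists (v - q - 1); rewrite !qinfE; split=> //; lra.
- by exists 0.
Qed.

Lemma bigmin_attained (I : finType) (P : pred I) (F : I -> qinf) :
  \big[Order.min/infty]_(i | P i) F i < infty ->
  exists2 i, P i & \big[Order.min/infty]_(i | P i) F i = F i.
Proof.
case: (pickP P) => [j Pj _|P0]; last by rewrite big_pred0.
have [i Pi minE] := eq_bigmin j P F Pj (fun i _ => qle_infty (F i)).
by exists i.
Qed.

Lemma ord2_eq01 (i : 'I_2) : i = 0 \/ i = 1.
Proof.
by case: i => [[|[|//]] lt_i]; [left | right]; exact: val_inj.
Qed.

Section WeightedRelations.
Variable D : finType.

Lemma tuple2E (t : 2.-tuple D) : t = [tuple tnth t 0; tnth t 1].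
Proof.
case/tupleP: t => a t; case/tupleP: t => b t.
by rewrite tuple0; exact: val_inj.
Qed.

Lemma tnth_insert_lift r (k : 'I_r.+1) (c : D) (t : r.-tuple D) (i : 'I_r) :
  tnth (insert k c t) (lift k i) = tnth t i.
Proof. by rewrite tnth_mktuple liftK. Qed.

Lemma tnth_insert r (k : 'I_r.+1) (c : D) (t : r.-tuple D) :
  tnth (insert k c t) k = c.
Proof. by rewrite tnth_mktuple unlift_none. Qed.

Definition delete r (k : 'I_r.+1) (t : r.+1.-tuple D) : r.-tuple D :=
  [tuple tnth t (lift k i) | i < r].

Lemma insertK r (k : 'I_r.+1) (c : D) : cancel (insert k c) (delete k).
Proof.
by move=> t; apply: eq_from_tnth => i; rewrite tnth_mktuple tnth_insert_lift.
Qed.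

Lemma deleteK r (k : 'I_r.+1) (t : r.+1.-tuple D) :
  insert k (tnth t k) (delete k t) = t.
Proof.
apply: eq_from_tnth => i; rewrite tnth_mktuple.
by case: unliftP => [j ->|->] //; rewrite tnth_mktuple.
Qed.

Lemma vertex_swap (p : D * D) : vertex (swap_pair p) = vertex p.
Proof. by rewrite /vertex eq_sym. Qed.

Definition unary (f : D -> qinf) : wrel D 1 := [ffun x => f (tnth x 0)].

Lemma add_unaryE r (gamma : wrel D r) (f : D -> qinf) (i : 'I_r) x :
  add_unary gamma (unary f) i x = gamma x + f (tnth x i).
Proof. by rewrite !ffunE. Qed.

Definition restrict r (P : 'I_r -> pred D) (gamma : wrel D r) : wrel D r :=
  [ffun x => if [forall i, P i (tnth x i)] then gamma x else infty].

Definition projection r (i j : 'I_r) (gamma : wrel D r) : wrel D 2 :=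
  [ffun t => \big[Order.min/infty]_(x | (tnth x i == tnth t 0) &&
                                        (tnth x j == tnth t 1)) gamma x].

Lemma projection_minimise r (k : 'I_r.+1) (i j : 'I_r) (gamma : wrel D r.+1) :
  projection i j (minimise gamma k) = projection (lift k i) (lift k j) gamma.
Proof.
apply/ffunP => t; rewrite !ffunE.
under eq_bigr do rewrite ffunE.
rewrite pair_big_dep /= [RHS](reindex (fun p => insert k p.2 p.1)) /=.
  by apply: eq_bigl => p; rewrite !tnth_insert_lift andbT.
exists (fun x => (delete k x, tnth x k)) => [[x c] _|x _] /=.
  by rewrite insertK tnth_insert.
exact: deleteK.
Qed.

Lemma projection_id (gamma : wrel D 2) : projection 0 1 gamma = gamma.
Proof.
apply/ffunP => t; rewrite ffunE (big_pred1 t) // => x.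
apply/andP/eqP => [[/eqP x0 /eqP x1]|->] //.
by rewrite [x]tuple2E x0 x1 -tuple2E.
Qed.

Lemma projection_converse (gamma : wrel D 2) :
  projection 1 0 gamma = Defs.join false true gamma (Defs.eqrel D).
Proof.
apply/ffunP => t; rewrite [t]tuple2E join_eqrelE ffunE.
rewrite (big_pred1 [tuple tnth t 1; tnth t 0]) // => x.
apply/andP/eqP => [[/eqP x1 /eqP x0]|->] //.
by rewrite [x]tuple2E x0 x1.
Qed.

Lemma projection_le r (i j : 'I_r) (gamma : wrel D r) x :
  projection i j gamma [tuple tnth x i; tnth x j] <= gamma x.
Proof. by rewrite ffunE; apply: bigmin_le_cond; rewrite !eqxx. Qed.

Lemma projection_attained r (i j : 'I_r) (gamma : wrel D r) a b :
  feas (projection i j gamma) [tuple a; b] ->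
  exists x, [/\ tnth x i = a, tnth x j = b &
                gamma x = projection i j gamma [tuple a; b]].
Proof.
rewrite /feas ffunE => /bigmin_attained[x /andP[/eqP xi /eqP xj] ->].
by exists x.
Qed.

Lemma join_compositionE (gamma1 gamma2 : wrel D 2) a b :
  Defs.join true false gamma1 gamma2 [tuple a; b] =
  \big[Order.min/infty]_(c : D) (gamma1 [tuple a; c] + gamma2 [tuple c; b]).
Proof. by rewrite ffunE. Qed.

End WeightedRelations.

Section Mix.
Variables (D : finType) (r : nat) (S : pred 'I_r).
Implicit Types (gamma : wrel D r) (x y u v : r.-tuple D).

Definition mix x y : r.-tuple D :=
  [tuple if S i then tnth y i else tnth x i | i < r].

Lemma mix_mix x y u v : mix (mix x y) (mix u v) = mix x v.
Proof. by apply: eq_from_tnth => i; rewrite !tnth_mktuple; case: (S i). Qed.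

Lemma mixxx x : mix x x = x.
Proof. by apply: eq_from_tnth => i; rewrite tnth_mktuple if_same. Qed.

Lemma mix_idl x y : (forall i, S i -> tnth x i = tnth y i) -> mix x y = x.
Proof.
move=> eq_xy; apply: eq_from_tnth => i; rewrite tnth_mktuple.
by case: ifPn => // /eq_xy.
Qed.

Lemma mix_idr x y : (forall i, ~~ S i -> tnth x i = tnth y i) -> mix x y = y.
Proof.
move=> eq_xy; apply: eq_from_tnth => i; rewrite tnth_mktuple.
by case: ifPn => // /eq_xy.
Qed.

Definition submodular_at gamma x y : bool :=
  gamma (mix x y) + gamma (mix y x) <= gamma x + gamma y.

Lemma submodular_at_sym gamma x y :
  submodular_at gamma x y = submodular_at gamma y x.
Proof. by rewrite /submodular_at addrC [leRHS]addrC. Qed.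

(* The four inequalities add up; [gamma u] occurs twice on both sides. *)
Lemma submodular_at_uncross gamma x y u : feas gamma u ->
  submodular_at gamma x u -> submodular_at gamma u y ->
  submodular_at gamma (mix x u) (mix u y) ->
  submodular_at gamma (mix u x) (mix y u) ->
  submodular_at gamma x y.
Proof.
move=> feas_u; rewrite /submodular_at !mix_mix mixxx => le_xu le_uy le_y le_x.
have feas_uu : gamma u + gamma u < infty by rewrite add_lt_infty andbb.
rewrite -(qinf_leD2r _ _ feas_uu) addrACA [leRHS]addrACA.
rewrite [gamma (mix y x) + _]addrC [gamma y + _]addrC.
apply: le_trans (qinf_leD le_y le_x) _; rewrite addrACA.
exact: qinf_leD le_xu le_uy.
Qed.

Definition contraction x y x' y' : Prop := forall i,
  tnth x' i = tnth y' i \/ (tnth x' i, tnth y' i) = (tnth x i, tnth y i).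

Lemma contraction_mix x y u u' v v' : contraction x y u u' ->
  contraction x y v v' -> contraction x y (mix u v) (mix u' v').
Proof. by move=> cu cv i; rewrite !tnth_mktuple; case: (S i). Qed.

Definition hamming x y : nat := #|[pred i | tnth x i != tnth y i]|.

Lemma hammingC x y : hamming x y = hamming y x.
Proof. by apply: eq_card => i; rewrite !inE eq_sym. Qed.

Lemma hamming_contraction x y x' y' i : contraction x y x' y' ->
  tnth x' i = tnth y' i -> tnth x i != tnth y i ->
  (hamming x' y' < hamming x y)%N.
Proof.
move=> contr eq_i neq_i; apply/proper_card/properP; split.
  apply/subsetP => k; rewrite !inE.
  by case: (contr k) => [->|[-> ->]]; rewrite ?eqxx.
by exists i; rewrite !inE // eq_i eqxx.
Qed.

Definition between x y u : bool :=
  [forall i, pred2 (tnth x i) (tnth y i) (tnth u i)].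

Lemma betweenP x y u :
  reflect (forall i, tnth u i = tnth x i \/ tnth u i = tnth y i)
          (between x y u).
Proof. by apply: (iffP forallP) => in_xy i; apply/pred2P/in_xy. Qed.

Lemma betweenC x y u : between x y u = between y x u.
Proof. by apply: eq_forallb => i /=; rewrite orbC. Qed.

Lemma contraction_betweenl x y u : between x y u -> contraction x y x u.
Proof. by move=> /betweenP in_xy i; case: (in_xy i) => ->; [left | right]. Qed.

Lemma contraction_betweenr x y u : between x y u -> contraction x y u y.
Proof. by move=> /betweenP in_xy i; case: (in_xy i) => ->; [right | left]. Qed.

End Mix.

Section Closure.
Variables (D : finType) (Gamma : language D).

Local Notation C := (@Defs.closure D Gamma _).

Lemma closure_restrict r (P : 'I_r -> pred D) (gamma : wrel D r) :
  C gamma -> C (restrict P gamma).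
Proof.
move=> Cg; pose on s x := all (fun i => P i (tnth x i)) s.
suff: C [ffun x => if on (enum 'I_r) x then gamma x else infty].
  congr (Defs.closure _ _); apply/ffunP => x; rewrite !ffunE.
  congr (if _ then _ else _).
  apply/allP/forallP => [Px i|Px i _]; last exact: Px.
  by apply: Px; rewrite mem_enum.
elim: (enum _) => [|i s IHs].
  by rewrite (_ : finfun _ = gamma) //; apply/ffunP => x; rewrite ffunE.
have := closure_add_unary (unary (fun a => if P i a then 0 else infty)) i IHs.
congr (Defs.closure _ _); apply/ffunP => x; rewrite add_unaryE !ffunE /=.
by case: (P i _); rewrite ?addr0 ?addr_infty.
Qed.

Lemma closure_projection r (i j : 'I_r) (gamma : wrel D r) :
  i != j -> C gamma -> C (projection i j gamma).
Proof.
elim: r i j gamma => [[[]]|[|[|r]] IHr i j gamma neq_ij Cg] //.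
- by rewrite (ord1 i) (ord1 j) eqxx in neq_ij.
- case: (ord2_eq01 i) (ord2_eq01 j) neq_ij => -> [] -> // _.
  + by rewrite projection_id.
  + rewrite projection_converse; apply: closure_join => //.
    exact: closure_eq.
- have [k] : exists k, k \in ~: [set i; j].
    by apply/set0Pn; rewrite -card_gt0 cardsCs setCK card_ord cards2 neq_ij.
  rewrite !inE negb_or.
  case/andP=> /unlift_some[i' def_i _] /unlift_some[j' def_j _].
  rewrite def_i def_j -projection_minimise.
  apply: IHr; last exact: closure_minimise.
  by apply: contraNneq neq_ij => eq_ij; rewrite def_i def_j eq_ij.
Qed.

Lemma edge_swap p q :
  edge Gamma p q -> edge Gamma (swap_pair p) (swap_pair q).
Proof.
case=> vp vq [g [Cg /and3P[feas12 feas21 lt_g]]].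
split; rewrite ?vertex_swap //.
exists g; split=> //; apply/and3P; split=> //.
by rewrite addrC [ltRHS]addrC.
Qed.

Lemma edge_swap_self p : vertex p -> edge Gamma p (swap_pair p).
Proof.
move=> vp; split; rewrite ?vertex_swap //.
exists (Defs.eqrel D); split; first exact: closure_eq.
by rewrite /edge_witness /feas !ffunE /tnth /= !eqxx (negbTE vp).
Qed.

Lemma not_edge_le p q (g : wrel D 2) : C g -> ~ edge Gamma p q ->
  g [tuple p.1; q.1] + g [tuple p.2; q.2] <=
  g [tuple p.1; q.2] + g [tuple p.2; q.1].
Proof.
move=> Cg no_edge; rewrite leNgt; apply/negP => lt_g; apply: no_edge.
have : g [tuple p.1; q.2] + g [tuple p.2; q.1] < infty.
  exact: lt_le_trans lt_g (qle_infty _).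
rewrite add_lt_infty => /andP[feas12 feas21].
split; last by exists g; split; rewrite // /edge_witness /feas feas12 feas21.
  by apply: contraTneq lt_g => ->; rewrite addrC ltxx.
by apply: contraTneq lt_g => ->; rewrite ltxx.
Qed.

Definition separates (g : wrel D 2) (p q : D * D) : Prop :=
  [/\ g [tuple p.1; q.2] = 0, g [tuple p.2; q.1] = 0,
      (0 : qinf) < g [tuple p.1; q.1] & (0 : qinf) < g [tuple p.2; q.2]].

(* If the witness takes the values [alpha] and [beta] on the mixed pairs, add
   the weights [- alpha] on [p.1], [- beta - m] on [p.2] and [m] on [q.1]; a
   suitable [m] makes both remaining values positive. *)
Lemma edge_separated p q : edge Gamma p q ->
  exists g, [/\ C g, separates g p q &
    forall a c, c != q.1 -> c != q.2 -> g [tuple a; c] = infty].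
Proof.
case=> vp vq [g [Cg /and3P[/lt_inftyP[alpha alphaE] /lt_inftyP[beta betaE]]]].
rewrite alphaE betaE => /qfin_add_lt_separate[m [gt11 gt22]].
pose f1 a := qfin (if a == p.1 then - alpha else - beta - m).
pose f2 c := if c == q.1 then qfin m else if c == q.2 then 0 else infty.
have [f1p1 f2q1] : f1 p.1 = qfin (- alpha) /\ f2 q.1 = qfin m.
  by rewrite /f1 /f2 !eqxx.
have [f1p2 f2q2] : f1 p.2 = qfin (- beta - m) /\ f2 q.2 = 0.
  by rewrite /f1 /f2 eqxx ![_.2 == _]eq_sym (negbTE vp) (negbTE vq).
pose h := add_unary (add_unary g (unary f1) 0) (unary f2) 1.
have hE a c : h [tuple a; c] = g [tuple a; c] + f1 a + f2 c.
  by rewrite !add_unaryE.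
exists h; split; first by do 2!apply: closure_add_unary.
- rewrite /separates !hE f1p1 f1p2 f2q1 f2q2 alphaE betaE !addr0 !qinfE.
  split; try by congr qfin; lra.
    by move: gt11; case: (g _) => // s; rewrite !qinfE; lra.
  by move: gt22; case: (g _) => // s; rewrite !qinfE; lra.
- by move=> a c cq1 cq2; rewrite hE /f2 (negbTE cq1) (negbTE cq2) addr_infty.
Qed.

Lemma separates_edge (g : wrel D 2) p q : C g -> vertex p -> vertex q ->
  g [tuple p.1; q.2] <= 0 -> g [tuple p.2; q.1] <= 0 ->
  (0 : qinf) < g [tuple p.1; q.1] -> (0 : qinf) < g [tuple p.2; q.2] ->
  edge Gamma p q.
Proof.
move=> Cg vp vq le12 le21 gt11 gt22; split=> //; exists g; split=> //.
apply/and3P; split; [exact: le_lt_trans le12 _ | exact: le_lt_trans le21 _ |].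
apply: le_lt_trans (qinf_leD le12 le21) _.
by rewrite addr0; exact: qinf_addr_gt0.
Qed.

Lemma edge_comp p q r :
  edge Gamma p q -> edge Gamma q r -> edge Gamma p (swap_pair r).
Proof.
move=> /[dup] [[vp _ _]] /edge_separated[g1 [Cg1 [p1q2 p2q1 p1q1 p2q2] g1_off]].
move=> /[dup] [[_ vr _]] /edge_separated[g2 [Cg2 [q1r2 q2r1 q1r1 q2r2] _]].
have Cg : C (Defs.join true false g1 g2) by exact: closure_join.
have join_gt0 a b : (0 : qinf) < g1 [tuple a; q.1] + g2 [tuple q.1; b] ->
    (0 : qinf) < g1 [tuple a; q.2] + g2 [tuple q.2; b] ->
    (0 : qinf) < Defs.join true false g1 g2 [tuple a; b].
  move=> gt1 gt2; rewrite join_compositionE; apply: lt_bigmin => // c _.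
  have [->//|cq1] := eqVneq c q.1; have [->//|cq2] := eqVneq c q.2.
  by rewrite g1_off.
apply: (separates_edge Cg) => //; rewrite ?vertex_swap //=.
- rewrite join_compositionE; apply: (bigmin_inf q.2) => //.
  by rewrite p1q2 q2r1 addr0.
- rewrite join_compositionE; apply: (bigmin_inf q.1) => //.
  by rewrite p2q1 q1r2 addr0.
- by apply: join_gt0; [rewrite q1r2 addr0 | rewrite p1q2 add0r].
- by apply: join_gt0; [rewrite p2q1 add0r | rewrite q2r1 addr0].
Qed.

Lemma edge_loop p q : edge Gamma p q -> edge Gamma q q -> edge Gamma p p.
Proof.
move=> edge_pq loop_q; have edge_pq' := edge_comp edge_pq loop_q.
have edge_qp' : edge Gamma q (swap_pair p).
  by rewrite -[q]swap_pairK; exact: edge_swap (edge_sym edge_pq').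
by rewrite -[X in edge _ _ X]swap_pairK; exact: edge_comp edge_pq edge_qp'.
Qed.

Lemma loopless_swap p : loopless Gamma p -> loopless Gamma (swap_pair p).
Proof.
case=> vp noloop; split; first by rewrite vertex_swap.
by move/edge_swap; rewrite swap_pairK.
Qed.

Lemma bipartition_not_edge_swap (M1 M2 : {set D * D}) p q :
  bipartition (loopless Gamma) M1 M2 ->
  independent Gamma M1 -> independent Gamma M2 ->
  p \in M2 -> q \notin M2 -> ~ edge Gamma p (swap_pair q).
Proof.
move=> [M_iff _] ind1 ind2 M2p M2'q edge_pq.
have [_ noloop_p] : loopless Gamma p by apply/M_iff; rewrite inE M2p orbT.
have loopless_q : loopless Gamma q.
  split; first by case: edge_pq => _; rewrite vertex_swap.
  by move=> /edge_swap /(edge_loop edge_pq).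
have M1q : q \in M1.
  by move/M_iff: loopless_q; rewrite inE (negbTE M2'q) orbF.
have /M_iff := loopless_swap loopless_q; rewrite inE => /orP[M1q'|M2q'].
  by apply: ind1 M1q M1q' (edge_swap_self _); case: loopless_q.
exact: ind2 M2p M2q' edge_pq.
Qed.

Section Exchange.
Variables (r : nat) (S : pred 'I_r).
Implicit Types (gamma : wrel D r) (x y u v : r.-tuple D).

Definition exchangeable x y : Prop := forall i j, S i -> ~~ S j ->
  ~ edge Gamma (tnth x i, tnth y i) (tnth y j, tnth x j).

Lemma exchangeable_sym x y : exchangeable x y -> exchangeable y x.
Proof. by move=> exch i j Si Sj /edge_swap; exact: exch. Qed.

Lemma exchangeable_contraction x y x' y' :
  contraction x y x' y' -> exchangeable x y -> exchangeable x' y'.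
Proof.
move=> contr exch i j Si Sj; case: (contr i) => [->|[-> ->]].
  by case; rewrite /vertex eqxx.
case: (contr j) => [->|[-> ->]]; last exact: exch.
by case; rewrite /vertex eqxx.
Qed.

Lemma exchange_between gamma x y i j : C gamma -> i != j ->
  ~ edge Gamma (tnth x i, tnth y i) (tnth y j, tnth x j) ->
  feas gamma x -> feas gamma y ->
  exists u v, [/\ between x y u /\ between x y v,
    tnth u i = tnth y i /\ tnth u j = tnth x j,
    tnth v i = tnth x i /\ tnth v j = tnth y j &
    gamma u + gamma v <= gamma x + gamma y].
Proof.
move=> Cg neq_ij no_edge feas_x feas_y.
pose box := restrict (fun k => pred2 (tnth x k) (tnth y k)) gamma.
have boxE w : box w = if between x y w then gamma w else infty by rewrite ffunE.
have box_x : box x = gamma x.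
  by rewrite boxE ifT //; apply/betweenP => k; left.
have box_y : box y = gamma y.
  by rewrite boxE ifT //; apply/betweenP => k; right.
have box_between w : feas box w -> between x y w.
  by rewrite /feas boxE; case: ifP.
pose g := projection i j box.
have le_g : g [tuple tnth y i; tnth x j] + g [tuple tnth x i; tnth y j] <=
    gamma x + gamma y.
  rewrite -box_x -box_y.
  apply: le_trans (qinf_leD (projection_le i j _ _) (projection_le i j _ _)).
  rewrite addrC; apply: not_edge_le no_edge.
  by apply: closure_projection => //; exact: closure_restrict.
have: g [tuple tnth y i; tnth x j] + g [tuple tnth x i; tnth y j] < infty.
  by apply: le_lt_trans le_g _; rewrite add_lt_infty; apply/andP.
rewrite add_lt_infty => /andP[feas_yx feas_xy].
have [u [ui uj uE]] := projection_attained feas_yx.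
have [v [vi vj vE]] := projection_attained feas_xy.
have between_u : between x y u by apply: box_between; rewrite /feas uE.
have between_v : between x y v by apply: box_between; rewrite /feas vE.
exists u, v; split=> //.
by move: uE vE; rewrite !boxE between_u between_v => -> ->.
Qed.

Lemma submodular_at_closer gamma x y i j u :
  (forall x' y', (hamming x' y' < hamming x y)%N -> exchangeable x' y' ->
    submodular_at S gamma x' y') ->
  exchangeable x y -> between x y u -> feas gamma u -> u != mix S x y ->
  tnth x i != tnth y i -> tnth u i = tnth y i ->
  tnth x j != tnth y j -> tnth u j = tnth x j ->
  S i -> ~~ S j -> submodular_at S gamma x y.
Proof.
move=> IH exch between_u feas_u neq_u neq_i ui neq_j uj Si Sj.
have IH_contraction x' y' k : contraction x y x' y' ->
    tnth x' k = tnth y' k -> tnth x k != tnth y k ->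
    submodular_at S gamma x' y'.
  move=> contr eq_k neq_k; apply: IH; last exact: exchangeable_contraction exch.
  exact: hamming_contraction contr eq_k neq_k.
have contr_xu := contraction_betweenl between_u.
have contr_uy := contraction_betweenr between_u.
have [k neq_uk] : exists k, tnth u k != tnth (mix S x y) k.
  apply/existsP; apply: contraNT neq_u => /existsPn eq_u.
  by apply/eqP/eq_from_tnth => k; apply/eqP/negPn.
have neq_k : tnth x k != tnth y k.
  apply: contraNneq neq_uk; rewrite tnth_mktuple.
  by case: (betweenP _ _ _ between_u k) => -> ->; rewrite if_same.
apply: (submodular_at_uncross feas_u).
- by apply: IH_contraction contr_xu _ neq_j.
- by apply: IH_contraction contr_uy _ neq_i.
- apply: IH_contraction (contraction_mix S contr_xu contr_uy) _ neq_i.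
  by rewrite !tnth_mktuple Si.
- apply: IH_contraction (contraction_mix S contr_uy contr_xu) _ neq_k.
  move: neq_uk; rewrite !tnth_mktuple.
  by case: (S k); case: (betweenP _ _ _ between_u k) => ->; rewrite ?eqxx.
Qed.

Lemma exchangeable_submodular gamma x y :
  C gamma -> exchangeable x y -> submodular_at S gamma x y.
Proof.
move=> Cg; have [n] := ubnP (hamming x y).
elim: n x y => // n IHn x y le_n exch.
have IH a b : (hamming a b < hamming x y)%N -> exchangeable a b ->
    submodular_at S gamma a b.
  by move=> lt_ab; apply: IHn; exact: leq_trans lt_ab _.
have [feas_xy|] := boolP (feas gamma x && feas gamma y); last first.
  by rewrite -add_lt_infty -leNgt => /(le_trans _); apply; exact: qle_infty.
case/andP: feas_xy => feas_x feas_y.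
have [/existsP[i /andP[Si neq_i]]|eq_in] :=
    boolP [exists i, S i && (tnth x i != tnth y i)]; last first.
  have {}eq_in i : S i -> tnth x i = tnth y i.
    by move=> Si; move/existsPn/(_ i): eq_in; rewrite Si => /negPn/eqP.
  by rewrite /submodular_at !mix_idl // => i /eq_in.
have [/existsP[j /andP[Sj neq_j]]|eq_out] :=
    boolP [exists j, ~~ S j && (tnth x j != tnth y j)]; last first.
  have {}eq_out j : ~~ S j -> tnth x j = tnth y j.
    by move=> Sj; move/existsPn/(_ j): eq_out; rewrite Sj => /negPn/eqP.
  by rewrite /submodular_at addrC !mix_idr // => j /eq_out.
have neq_ij : i != j by apply: contraNneq Sj => <-.
have [u [v [[between_u between_v] [ui uj] [vi vj] le_uv]]] :=
  exchange_between Cg neq_ij (exch i j Si Sj) feas_x feas_y.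
have /andP[feas_u feas_v] : feas gamma u && feas gamma v.
  rewrite -add_lt_infty; apply: le_lt_trans le_uv _.
  by rewrite add_lt_infty; apply/andP.
have [eq_u|neq_u] := eqVneq u (mix S x y); last first.
  exact: submodular_at_closer IH exch between_u feas_u neq_u
    neq_i ui neq_j uj Si Sj.
have [eq_v|neq_v] := eqVneq v (mix S y x); last first.
  rewrite submodular_at_sym.
  apply: submodular_at_closer (exchangeable_sym exch) _ feas_v neq_v
    _ vi _ vj Si Sj.
  - by move=> a b; rewrite [hamming y x]hammingC; exact: IH.
  - by rewrite betweenC.
  - by rewrite eq_sym.
  - by rewrite eq_sym.
by rewrite /submodular_at -eq_u -eq_v.
Qed.

End Exchange.
End Closure.

Section BinaryMultimorphism.
Variables (D : finType) (r : nat).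

Definition map2_tuple (f : D -> D -> D) (x y : r.-tuple D) : r.-tuple D :=
  [tuple f (tnth x i) (tnth y i) | i < r].

Lemma apply_binary_op (f : D -> D -> D) (xs : 2.-tuple (r.-tuple D)) :
  apply_op (binary_op f) xs = map2_tuple f (tnth xs 0) (tnth xs 1).
Proof.
by apply: eq_from_tnth => i; rewrite !tnth_mktuple /binary_op !tnth_mktuple.
Qed.

Lemma binary_multimorphism_of (f g : D -> D -> D) (gamma : wrel D r) :
  (forall x y, gamma (map2_tuple f x y) + gamma (map2_tuple g x y) <=
               gamma x + gamma y) ->
  multimorphism_of [tuple binary_op f; binary_op g] gamma.
Proof.
move=> le_fg xs feas_xs; have := le_fg (tnth xs 0) (tnth xs 1).
rewrite -!apply_binary_op => {}le_fg.
have: gamma (tnth xs 0) + gamma (tnth xs 1) < infty.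
  by rewrite add_lt_infty; apply/andP; split; exact: feas_xs.
move=> /(le_lt_trans le_fg); rewrite add_lt_infty => /andP[feas_f feas_g].
split=> [i|]; first by case: (ord2_eq01 i) => ->.
by rewrite !big_ord_recl !big_ord0 !addr0 (_ : lift _ _ = 1) //; exact: val_inj.
Qed.

End BinaryMultimorphism.

Section MeetJoin.
Variables (D : finType) (M1 M2 : {set D * D}).
Hypothesis M12_disjoint : [disjoint M1 & M2].

Lemma sqcapE x y : sqcap M1 M2 x y = if (x, y) \in M2 then y else x.
Proof.
rewrite /sqcap /meet_join; case: ifP => [M1xy|_]; last by case: ifP.
by rewrite (disjointFr M12_disjoint M1xy).
Qed.

Lemma sqcupE x y : sqcup M1 M2 x y = if (x, y) \in M2 then x else y.
Proof.
rewrite /sqcup /meet_join; case: ifP => [M1xy|_]; last by case: ifP.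
by rewrite (disjointFr M12_disjoint M1xy).
Qed.

End MeetJoin.

Theorem theorem4p13 (D : finType) (Gamma : language D) (M1 M2 : {set D * D})
  (Gamma_conservative : conservative Gamma)
  (no_soft_loop : forall p : D * D, ~ soft_edge Gamma p p)
  (M_partition : bipartition (loopless Gamma) M1 M2)
  (M1_independent : independent Gamma M1)
  (M2_independent : independent Gamma M2) :
  multimorphism
    [tuple binary_op (sqcap M1 M2); binary_op (sqcup M1 M2)] Gamma.
Proof.
move=> r gamma Ggamma; apply: binary_multimorphism_of => x y.
have [_ M12_disjoint] := M_partition.
pose S i := (tnth x i, tnth y i) \in M2.
have -> : map2_tuple (sqcap M1 M2) x y = mix S x y.
  by apply: eq_from_tnth => i; rewrite !tnth_mktuple sqcapE.
have -> : map2_tuple (sqcup M1 M2) x y = mix S y x.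
  by apply: eq_from_tnth => i; rewrite !tnth_mktuple sqcupE.
apply: (exchangeable_submodular (closure_base Ggamma)) => i j.
exact: bipartition_not_edge_swap M_partition M1_independent M2_independent.
Qed.
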